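(* Let $U$ be the Koopman operator on $L_2(\nu)$ of an invertible measure-preserving transformation, let $f\in L_2(\nu)$, let $\mu_f$ be the spectral measure of $U$ associated to $f$, and let $N\ge1$. Suppose that orthogonal polynomials up to degree $N$ associated to $\mu_f$ exist. Then the monic degree-$N$ orthogonal polynomial $\Phi_N$ for $\mu_f$ is equal to the characteristic polynomial of the Hankel DMD operator $U_N$. In particular, the zeros of $\Phi_N$ are equal to the eigenvalues of $U_N$, including multiplicities.
   Context: Setting: $(\mathcal{X},\mathfrak{M},\nu)$ is a measure space and $T:\mathcal{X}\to\mathcal{X}$ is an invertible measure-preserving transformation: a measurable bijection with measurable inverse such that $\nu(T^{-1}(A))=\nu(A)$ for all $A\in\mathfrak{M}$. The Koopman operator $U:L_2(\nu)\to L_2(\nu)$, $Uf=f\circ T$, is unitary; let $E$ be its projection-valued spectral measure on the unit circle $\mathbb{T}$. For $f\in L_2(\nu)$, $\mu_f$ is the positive measure on $\mathbb{T}$ given by $\mu_f(A)=\langle E(A)f,f\rangle$; its moments are $\int_{\mathbb{T}}z^k\,d\mu_f=\langle U^kf,f\rangle$, $k\in\mathbb{Z}$. Hankel DMD operator (in the limit of infinitely many samples): let $\mathcal{F}_N=\mathrm{span}\{f,Uf,\ldots,U^{N-1}f\}$ and let $P_N$ be the $L_2(\nu)$-orthogonal projection onto $\mathcal{F}_N$; then $U_N=P_NUP_N$, regarded as an operator on $\mathcal{F}_N$ (i.e. restricted to $\mathcal{F}_N$). Orthogonal polynomials: $\Phi_0,\ldots,\Phi_N$ are monic complex polynomials with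 $\deg\Phi_k=k$, mutually orthogonal in $L_2(\mu_f)$. Their existence and uniqueness up to degree $N$ is assured if the support of $\mu_f$ contains at least $N+1$ distinct points. *)

(* Defs.v *)
From HB Require Import structures.
From mathcomp Require Import all_boot all_order all_algebra.
From mathcomp Require Import ring_quotient.
From mathcomp Require Import all_classical all_reals all_analysis.
From mathcomp Require Import measurable_realfun complex ring.

Set Implicit Arguments.
Unset Strict Implicit.
Unset Printing Implicit Defensive.

Import Order.TTheory GRing.Theory Num.Theory.
Import numFieldNormedType.Exports.

Local Open Scope classical_set_scope.
Local Open Scope ring_scope.

Section complex_functions.
Context d (X : measurableType d) (R : realType).

Definition cmeasurable (f : X -> R[i]) :=
  measurable_fun setT (fun x => complex.Re (f x)) /\
  measurable_fun setT (fun x => complex.Im (f x)).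

Definition cintegral (mu : {measure set X -> \bar R}) (f : X -> R[i]) : R[i] :=
  Complex (\int[mu]_x complex.Re (f x)) (\int[mu]_x complex.Im (f x)).

Definition square_integrable (mu : {measure set X -> \bar R}) (f : X -> R[i]) :=
  cmeasurable f /\ (\int[mu]_x (Normc.normc (f x) ^+ 2)%:E < +oo)%E.

End complex_functions.

Section L2_space.
Context d (X : measurableType d) (R : realType).
Variable nu : {measure set X -> \bar R}.

Definition in_L2 : {pred X -> R[i]} := fun f => `[< square_integrable nu f >].

Lemma normc2E (z : R[i]) :
  Normc.normc z ^+ 2 = complex.Re z ^+ 2 + complex.Im z ^+ 2.
Proof. by case: z => a b /=; rewrite sqr_sqrtr// addr_ge0 ?sqr_ge0. Qed.

Lemma measurable_normc2 (f : X -> R[i]) : cmeasurable f ->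
  measurable_fun setT (fun x => (Normc.normc (f x) ^+ 2)%:E : \bar R).
Proof.
move=> [mR mI]; apply/measurable_EFinP.
under eq_fun do rewrite normc2E.
by apply: measurable_funD; exact: measurable_funX.
Qed.

Lemma in_L2_submod_closed : submod_closed in_L2.
Proof.
split.
  apply/asboolP; split; first by split; exact: measurable_cst.
  by under eq_integral do rewrite normc2E /= expr0n addr0; rewrite integral0.
move=> a f g /asboolP[mf ff] /asboolP[mg fg].
have mafg : cmeasurable (a *: f + g).
  case: mf mg => mf1 mf2 [mg1 mg2]; case: a => a b; split.
  - rewrite (_ : (fun _ => _) = (fun x => (a * complex.Re (f x)
      - b * complex.Im (f x)) + complex.Re (g x))); last first.
      by apply/funext => x; rewrite /GRing.add /GRing.scale /=;
         case: (f x) (g x) => ? ? [].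
    by apply: measurable_funD => //; apply: measurable_funB;
      apply: measurable_funM.
  - rewrite (_ : (fun _ => _) = (fun x => (a * complex.Im (f x)
      + b * complex.Re (f x)) + complex.Im (g x))); last first.
      by apply/funext => x; rewrite /GRing.add /GRing.scale /=;
         case: (f x) (g x) => ? ? [].
    by apply: measurable_funD => //; apply: measurable_funD;
      apply: measurable_funM.
apply/asboolP; split => //.
pose h x := ((2 * Normc.normc a ^+ 2)%:E * (Normc.normc (f x) ^+ 2)%:E
             + 2%:E * (Normc.normc (g x) ^+ 2)%:E)%E.
have m1 := measurable_normc2 mf; have m2 := measurable_normc2 mg.
have p x : (0 <= (Normc.normc (f x) ^+ 2)%:E)%E by rewrite lee_fin sqr_ge0.
have q x : (0 <= (Normc.normc (g x) ^+ 2)%:E)%E by rewrite lee_fin sqr_ge0.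
have c0 : 0 <= 2 * Normc.normc a ^+ 2 by rewrite mulr_ge0 ?sqr_ge0.
apply: (@le_lt_trans _ _ (\int[nu]_x h x)%E).
  apply: ge0_le_integral => //=.
  - by move=> x _; rewrite lee_fin sqr_ge0.
  - exact: measurable_normc2.
  - by apply: emeasurable_funD; apply: measurable_funeM.
  move=> x _; rewrite /h -!EFinM -EFinD lee_fin -mulrA -exprMn -Normc.normcM.
  rewrite !normc2E [_ x](_ : _ = a * f x + g x)//.
  move: (a * f x) (g x) => [u v] [w z] /=; rewrite -mulrDr.
  rewrite -subr_ge0 [leRHS](_ : _ = (u - w) ^+ 2 + (v - z) ^+ 2).
    by rewrite addr_ge0 ?sqr_ge0.
  by rewrite !sqrrD !sqrrN; ring.
rewrite ge0_integralD//; last 4 first.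
- by move=> x _; rewrite mule_ge0.
- exact: measurable_funeM.
- by move=> x _; rewrite mule_ge0.
- exact: measurable_funeM.
by rewrite !ge0_integralZl//; apply: lte_add_pinfty; apply: lte_mul_pinfty.
Qed.

HB.instance Definition _ :=
  GRing.isSubmodClosed.Build R[i] (X -> R[i]) in_L2 in_L2_submod_closed.

Definition L2fun : Type := {f : X -> R[i] | f \in in_L2}.

HB.instance Definition _ := SubType.on L2fun.
HB.instance Definition _ := [Choice of L2fun by <:].
HB.instance Definition _ := [SubChoice_isSubLmodule of L2fun by <:].

Definition null_fun : {pred L2fun} :=
  fun f => `[< {ae nu, forall x, val f x = 0} >].

Lemma null_fun_submod_closed : submod_closed null_fun.
Proof.
split; first by apply/asboolP; apply/aeW.
move=> a f g /asboolP f0 /asboolP g0; apply/asboolP.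
apply: filterS2 f0 g0 => x fx gx; rewrite linearP /=.
by rewrite [LHS](_ : _ = a * val f x + val g x)// fx gx mulr0 addr0.
Qed.

HB.instance Definition _ :=
  GRing.isSubmodClosed.Build R[i] L2fun null_fun null_fun_submod_closed.

(* L2(nu) over the complex numbers: square integrable functions modulo
   almost everywhere equality (see eq_L2). *)
Definition L2 : Type := Quotient.quot null_fun.

HB.instance Definition _ := EqQuotient.on L2.
HB.instance Definition _ := GRing.Zmodule.on L2.

Local Open Scope quotient_scope.

Lemma eq_L2 (f g : L2fun) :
  (\pi_L2 f = \pi_L2 g) <-> {ae nu, forall x, val f x = val g x}.
Proof.
split=> [/eqP|fg].
  rewrite -Quotient.idealrBE => /asboolP; apply: filterS => x.
  by rewrite raddfB/= => /eqP; rewrite subr_eq0 => /eqP.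
apply/eqP; rewrite -Quotient.idealrBE; apply/asboolP.
by apply: filterS fg => x fgx; rewrite raddfB /= /GRing.add/= /GRing.opp/= fgx subrr.
Qed.

Definition scaleL2 (a : R[i]) (u : L2) : L2 := \pi_L2 (a *: repr u).

Lemma pi_scaleL2 a f : scaleL2 a (\pi_L2 f) = \pi_L2 (a *: f).
Proof.
apply/eqP; rewrite -Quotient.idealrBE -scalerBr rpredZ//.
by rewrite Quotient.idealrBE reprK.
Qed.

Lemma scaleL2A a b u : scaleL2 a (scaleL2 b u) = scaleL2 (a * b) u.
Proof. by elim/quotW: u => f; rewrite (pi_scaleL2 b f) !pi_scaleL2 scalerA. Qed.
Lemma scale1L2 : left_id 1 scaleL2.
Proof. by elim/quotW=> f; rewrite pi_scaleL2 scale1r. Qed.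
Lemma scaleL2Dr : right_distributive scaleL2 +%R.
Proof.
move=> a; elim/quotW=> f; elim/quotW=> g.
by rewrite -raddfD !pi_scaleL2 scalerDr raddfD.
Qed.
Lemma scaleL2Dl u : {morph scaleL2^~ u : a b / a + b}.
Proof. by elim/quotW: u => f a b; rewrite !pi_scaleL2 scalerDl raddfD. Qed.

HB.instance Definition _ := GRing.Zmodule_isLmodule.Build R[i] L2
  scaleL2A scale1L2 scaleL2Dr scaleL2Dl.

Definition dotL2 (u v : L2) : R[i] :=
  cintegral nu (fun x => val (repr u) x * conjc (val (repr v) x)).

End L2_space.

Arguments dotL2 {d X R nu} u v.

Section koopman.
Context d (X : measurableType d) (R : realType).
Variable nu : {measure set X -> \bar R}.

Definition invertible_measure_preserving (T : X -> X) :=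
  [/\ measurable_fun setT T,
      exists S : X -> X, [/\ measurable_fun setT S, cancel T S & cancel S T] &
      forall A, measurable A -> nu (T @^-1` A) = nu A].

Lemma in_L2_comp T : invertible_measure_preserving T ->
  forall f : X -> R[i], f \in in_L2 nu -> f \o T \in in_L2 nu.
Proof.
move=> [mT _ Tnu] f /asboolP[mf ff]; apply/asboolP; split.
  case: mf => mf1 mf2; split.
    exact: (measurableT_comp mf1 mT).
  exact: (measurableT_comp mf2 mT).
rewrite [ltLHS](_ : _ = \int[nu]_x (Normc.normc (f x) ^+ 2)%:E)%E//.
rewrite -[LHS](@ge0_integral_pushforward _ _ _ _ _ _ mT nu setT
  (fun x => (Normc.normc (f x) ^+ 2)%:E))//=.
- by apply: eq_measure_integral => A mA _; exact: Tnu.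
- exact: measurable_normc2.
- by move=> x _; rewrite lee_fin sqr_ge0.
Qed.

Local Open Scope quotient_scope.

(* By measure preservation the class of f \o T does not depend on the chosen
   representative of the class u. *)
Definition koopman (T : X -> X) (hT : invertible_measure_preserving T)
    (u : L2 nu) : L2 nu :=
  \pi_(L2 nu) (Sub (val (repr u) \o T) (in_L2_comp hT (valP (repr u)))).

End koopman.

Section unit_circle.
Variable R : realType.

Definition unit_complex : Type := {z : R[i] | `|z| == 1}.

HB.instance Definition _ := SubType.on unit_complex.
HB.instance Definition _ := [Choice of unit_complex by <:].

Let normc1 : `|1 : R[i]| == 1. Proof. by rewrite normr1. Qed.

HB.instance Definition _ := isPointed.Build unit_complex (exist _ 1 normc1).

Definition circle_coord (z : unit_complex) :
    measurableTypeR R * measurableTypeR R :=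
  (complex.Re (val z), complex.Im (val z)).

(* The unit circle with its Borel sigma-algebra, which is the trace of the
   Borel sigma-algebra of the plane. *)
Definition circle : Type := g_sigma_algebra_preimageType circle_coord.

HB.instance Definition _ := SubType.on circle.
HB.instance Definition _ := Measurable.on circle.

End unit_circle.

Section spectral_measure.
Context d (X : measurableType d) (R : realType).
Variable nu : {measure set X -> \bar R}.

Definition orthogonal_projection (P : L2 nu -> L2 nu) :=
  [/\ linear P, idempotent_fun P &
      forall u v, dotL2 (P u) v = dotL2 u (P v)].

(* Projection-valued measure on the Borel sets of the circle. Only the values
   on Borel sets are constrained. Countable additivity is required of
   A |-> <E(A) g, g> for every g; by polarization and the other axioms this is
   equivalent to strong countable additivity of E. The real part loses
   nothing, since <E(A) g, g> = <E(A) g, E(A) g> is real. *)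
Record pvm := Pvm {
  pvm_op :> set (circle R) -> L2 nu -> L2 nu;
  pvm_proj : forall A, measurable A -> orthogonal_projection (pvm_op A);
  pvmT : pvm_op setT = id;
  pvmI : forall A B, measurable A -> measurable B ->
    pvm_op (A `&` B) = pvm_op A \o pvm_op B;
  pvm_sigma_additive : forall g,
    semi_sigma_additive (fun A => (complex.Re (dotL2 (pvm_op A g) g))%:E) }.

(* mu_g(A) = <E(A) g, g> for Borel A; the value 0 off the sigma-algebra is a
   convention that makes the function nonnegative on all sets. *)
Definition spectral_measure (E : pvm) (g : L2 nu) (A : set (circle R)) : \bar R :=
  if A \in measurable then (complex.Re (dotL2 (E A g) g))%:E else 0%E.

Section spectral_measure_is_measure.
Variables (E : pvm) (g : L2 nu).

Let mu0 : spectral_measure E g set0 = 0%E.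
Proof.
rewrite /spectral_measure mem_set//.
set c := complex.Re _.
have := @pvm_sigma_additive E g (fun=> set0).
rewrite bigcup0// => /(_ (fun=> measurable0) _ measurable0).
have tr0 : trivIset setT (fun _ : nat => @set0 (circle R)).
  by move=> i j _ _ [x []].
move/(_ tr0).
under eq_fun do rewrite sumEFin big_const_nat subn0 iter_addr_0 -/c.
move=> /fine_cvgP[_]; rewrite /comp/= -/c => h.
have h1 : c *+ n.+1 @[n --> \oo] --> c by rewrite (cvg_shiftS (fun n => c *+ n)).
have h2 : c *+ n.+1 @[n --> \oo] --> c + c.
  by under eq_fun do rewrite mulrS; apply: cvgD => //; exact: cvg_cst.
have /esym/eqP : c = c + c by exact: (cvg_unique _ h1 h2).
by rewrite -subr_eq0 addrK => /eqP ->.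
Qed.

Let mu_ge0 A : (0 <= spectral_measure E g A)%E.
Proof.
rewrite /spectral_measure; case: ifPn => // /set_mem mA.
have [_ EE Eadj] := pvm_proj E mA.
rewrite lee_fin -[E A g](EE g) Eadj /dotL2 /cintegral /=.
by apply: Rintegral_ge0 => x _; case: (val _ _) => a b /=;
  rewrite mulrN opprK addr_ge0 ?sqr_ge0.
Qed.

Let mu_sigma_additive : semi_sigma_additive (spectral_measure E g).
Proof.
move=> F mF tF mUF; rewrite /spectral_measure mem_set//.
under eq_fun do under eq_bigr do rewrite mem_set//.
exact: pvm_sigma_additive.
Qed.

HB.instance Definition _ := isMeasure.Build _ _ _ (spectral_measure E g)
  mu0 mu_ge0 mu_sigma_additive.

End spectral_measure_is_measure.

(* U = \int z dE(z) in the weak sense; the quadratic form determines the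
   operator by polarization. *)
Definition is_spectral_measure_of (U : L2 nu -> L2 nu) (E : pvm) :=
  forall g, dotL2 (U g) g = cintegral (spectral_measure E g) (fun z => val z).

End spectral_measure.

Section orthogonal_polynomials.
Variable R : realType.
Variable mu : {measure set (circle R) -> \bar R}.

Definition dot_poly (p q : {poly R[i]}) : R[i] :=
  cintegral mu (fun z => p.[val z] * conjc q.[val z]).

Definition monic_orthogonal (N : nat) (Phi : nat -> {poly R[i]}) :=
  (forall k, (k <= N)%N -> Phi k \is monic /\ size (Phi k) = k.+1) /\
  (forall j k, (j <= N)%N -> (k <= N)%N -> j != k ->
     dot_poly (Phi j) (Phi k) = 0).

(* The monic orthogonal polynomials up to degree N exist as uniquely determined
   objects. Uniqueness has to be part of existence: when mu is supported on
   fewer than N points, monic families with vanishing mutual inner products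
   still exist (some members being null in L2(mu)) but are not unique. *)
Definition orthogonal_polynomials (N : nat) (Phi : nat -> {poly R[i]}) :=
  monic_orthogonal N Phi /\
  forall Psi, monic_orthogonal N Psi -> forall k, (k <= N)%N -> Psi k = Phi k.

End orthogonal_polynomials.

Section finite_dimensional_operators.
Variables (K : fieldType) (W : lmodType K).
Implicit Types (V : set W) (L : W -> W).

Definition lincomb n (b : 'I_n -> W) (c : 'rV[K]_n) : W :=
  \sum_(i < n) c 0 i *: b i.

Definition span_of n (b : 'I_n -> W) : set W := range (lincomb b).

Definition basis_of_set V n (b : 'I_n -> W) :=
  injective (lincomb b) /\ span_of b = V.

(* Row convention: row i of M holds the coordinates of L (b i). This is the
   transpose of the usual matrix and has the same characteristic polynomial. *)
Definition is_matrix_of L n (b : 'I_n -> W) (M : 'M[K]_n) :=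
  forall i, L (b i) = lincomb b (row i M).

(* p is the characteristic polynomial of the operator that L induces on the
   finite-dimensional subspace V: every basis of V gives a matrix with
   characteristic polynomial p. *)
Definition is_char_poly V L (p : {poly K}) :=
  (exists n (b : 'I_n -> W), basis_of_set V b) /\
  forall n (b : 'I_n -> W), basis_of_set V b ->
    exists2 M : 'M[K]_n, is_matrix_of L b M & char_poly M = p.

Definition is_eigenvalue V L (a : K) :=
  exists u, [/\ V u, u != 0 & L u = a *: u].

(* Algebraic multiplicity; it is 0 when a is not an eigenvalue. *)
Definition has_multiplicity V L (a : K) (m : nat) :=
  exists2 p, is_char_poly V L p & mup a p = m.

End finite_dimensional_operators.

Section hankel_dmd.
Context d (X : measurableType d) (R : realType).
Variable nu : {measure set X -> \bar R}.
Variables (U : L2 nu -> L2 nu) (f : L2 nu) (N : nat).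

Definition krylov : set (L2 nu) := span_of (fun i : 'I_N => iter i U f).

(* The orthogonal projection onto V. It exists and is unique for finite-
   dimensional V, the only case used, so the default 0 is never selected. *)
Definition proj_on (V : set (L2 nu)) (u : L2 nu) : L2 nu :=
  xget 0 [set v | V v /\ forall w, V w -> dotL2 (u - v) w = 0].

(* P_N U P_N as an operator on the whole space; it maps krylov into itself and
   is always considered on krylov. *)
Definition hankel_dmd (u : L2 nu) : L2 nu :=
  proj_on krylov (U (proj_on krylov u)).

End hankel_dmd.

(* Main.v *)
Require Import Defs.
From HB Require Import structures.
From mathcomp Require Import all_boot all_order all_algebra.
From mathcomp Require Import all_classical all_reals all_analysis.
From mathcomp Require Import measurable_realfun complex ring lra.

Import Order.TTheory GRing.Theory Num.Theory.
Import numFieldNormedType.Exports.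

Local Open Scope classical_set_scope.
Local Open Scope ring_scope.

Set Implicit Arguments.
Unset Strict Implicit.

(* Since [|z| = 1] on the circle, the moments of [mu_f] being [<U^k f, f>] means that
   [p |-> p(U) f] is isometric from polynomials with the [L2(mu_f)] inner product to
   [L2(nu)]. Uniqueness of the orthogonal polynomials up to degree [N] then makes
   [f, ..., U^(N-1) f] free: a polynomial [p] of degree [< N] with [p(U) f = 0] could be
   added to [Phi_N]. As [Phi_N(U) f] is orthogonal to [F_N], the projection of
   [U^N f] onto [F_N] is [U^N f - Phi_N(U) f], so the matrix of [U_N] in the Krylov basis
   is the companion matrix of [Phi_N].

   The hypothesis on [E] only gives [<U g, g> = \int z dmu_g], so the higher moments
   need the multiplicativity of [E]. A partition of the circle into cells [A_j] of small
   diameter with sample points [c_j] gives an operator [S = \sum_j c_j E(A_j)], whose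
   powers satisfy [<S^k f, f> = \sum_j c_j^k mu_f(A_j)]. The quadratic form of [U - S] is
   small, hence by polarization so is its sesquilinear form; as [U] and the adjoint of [S]
   are isometric, [U^k] is weakly close to [S^k]. *)

(** * Linear combinations, and real and imaginary parts of complex numbers *)

Lemma linear_sum_scale (K : nzRingType) (V W : lmodType K) (g : V -> W) I (r : seq I)
    (a : I -> K) (v : I -> V) : linear g ->
  g (\sum_(i <- r) a i *: v i) = \sum_(i <- r) a i *: g (v i).
Proof.
move=> lg; elim: r => [|i r ih]; last by rewrite !big_cons lg ih.
(* Additivity at [0] reads [g 0 = g 0 + g 0], so [g 0 = 0]. *)
have := lg 1 0 0; rewrite !big_nil !scale1r addr0.
by move=> /(canLR (addKr _)); rewrite addNr.
Qed.

Section complex_parts.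
Variable R : rcfType.
Implicit Types x y : R[i].

Lemma Re_add x y : complex.Re (x + y) = complex.Re x + complex.Re y.
Proof. by case: x y => [? ?] []. Qed.
Lemma Im_add x y : complex.Im (x + y) = complex.Im x + complex.Im y.
Proof. by case: x y => [? ?] []. Qed.
Lemma Re_mul x y : complex.Re (x * y) =
  complex.Re x * complex.Re y - complex.Im x * complex.Im y.
Proof. by case: x y => [? ?] []. Qed.
Lemma Im_mul x y : complex.Im (x * y) =
  complex.Re x * complex.Im y + complex.Im x * complex.Re y.
Proof. by case: x y => [? ?] []. Qed.
Lemma Re_conjc x : complex.Re (conjc x) = complex.Re x.
Proof. by case: x. Qed.
Lemma Im_conjc x : complex.Im (conjc x) = - complex.Im x.
Proof. by case: x. Qed.

Lemma conjcD x y : conjc (x + y) = conjc x + conjc y.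
Proof. exact: rmorphD. Qed.
Lemma conjcB x y : conjc (x - y) = conjc x - conjc y.
Proof. exact: rmorphB. Qed.
Lemma conjcM x y : conjc (x * y) = conjc x * conjc y.
Proof. exact: rmorphM. Qed.
Lemma conjcX x n : conjc (x ^+ n) = conjc x ^+ n.
Proof. exact: rmorphXn. Qed.
Lemma conjc_sum I (s : seq I) (F : I -> R[i]) :
  conjc (\sum_(i <- s) F i) = \sum_(i <- s) conjc (F i).
Proof. exact: rmorph_sum. Qed.

Lemma normc_ge_Im x : `|complex.Im x|%:C%C <= `|x|.
Proof.
case: x => a b; rewrite normc_def lecR -sqrtr_sqr ler_sqrt ?addr_ge0 ?sqr_ge0//=.
by rewrite lerDr sqr_ge0.
Qed.

Lemma normc_ReIm x : `|x| <= (`|complex.Re x| + `|complex.Im x|)%:C%C.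
Proof.
case: x => a b; rewrite normc_def lecR /=.
rewrite -(@ler_pXn2r _ 2) ?nnegrE ?addr_ge0 ?sqrtr_ge0//.
rewrite sqr_sqrtr ?addr_ge0 ?sqr_ge0// sqrrD !real_normK ?num_real//.
by rewrite lerD2r lerDl mulrn_wge0 ?mulr_ge0.
Qed.

End complex_parts.

(** * Integration of complex-valued functions *)

Section complex_integral.
Context d (X : measurableType d) (R : realType).
Variable mu : {measure set X -> \bar R}.
Implicit Types (f g : X -> R[i]) (a : R[i]).

Definition cintegrable f :=
  mu.-integrable setT (EFin \o (fun x => complex.Re (f x))) /\
  mu.-integrable setT (EFin \o (fun x => complex.Im (f x))).

Lemma cintegrableD f g : cintegrable f -> cintegrable g ->
  cintegrable (fun x => f x + g x).
Proof.
move=> [fr fi] [gr gi]; split; rewrite /comp.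
  under eq_fun do rewrite Re_add EFinD; exact: integrableD.
under eq_fun do rewrite Im_add EFinD; exact: integrableD.
Qed.

Lemma cintegralD f g : cintegrable f -> cintegrable g ->
  cintegral mu (fun x => f x + g x) = cintegral mu f + cintegral mu g.
Proof.
move=> [fr fi] [gr gi]; apply/eqP; rewrite eq_complex /=; apply/andP; split.
  by under eq_Rintegral do rewrite Re_add; rewrite RintegralD.
by under eq_Rintegral do rewrite Im_add; rewrite RintegralD.
Qed.

(** Both parts of a product [a * f x] are real combinations of this form, so complex scaling reduces
    to the real case. *)
Lemma integrable_linear2 (u v : X -> R) (a b : R) :
  mu.-integrable setT (EFin \o u) -> mu.-integrable setT (EFin \o v) ->
  mu.-integrable setT (EFin \o (fun x => a * u x + b * v x)).
Proof.
move=> iu iv; rewrite /comp; under eq_fun do rewrite EFinD !EFinM.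
by apply: integrableD => //; apply: integrableZl.
Qed.

Lemma Rintegral_linear2 (u v : X -> R) (a b : R) :
  mu.-integrable setT (EFin \o u) -> mu.-integrable setT (EFin \o v) ->
  \int[mu]_x (a * u x + b * v x) = a * \int[mu]_x u x + b * \int[mu]_x v x.
Proof.
move=> iu iv; rewrite RintegralD ?RintegralZl//.
- by rewrite /comp; under eq_fun do rewrite EFinM; apply: integrableZl.
- by rewrite /comp; under eq_fun do rewrite EFinM; apply: integrableZl.
Qed.

Lemma cintegrableZl a f : cintegrable f -> cintegrable (fun x => a * f x).
Proof.
move=> [fr fi]; split; rewrite /comp.
  by under eq_fun do rewrite Re_mul -mulNr; exact: integrable_linear2.
by under eq_fun do rewrite Im_mul; exact: integrable_linear2.
Qed.

Lemma cintegralZl a f : cintegrable f ->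
  cintegral mu (fun x => a * f x) = a * cintegral mu f.
Proof.
move=> [fr fi]; apply/eqP; rewrite eq_complex Re_mul Im_mul /=; apply/andP; split.
  by under eq_Rintegral do rewrite Re_mul -mulNr; rewrite Rintegral_linear2// mulNr.
by under eq_Rintegral do rewrite Im_mul; rewrite Rintegral_linear2.
Qed.

Lemma cintegrable0 : cintegrable (fun=> 0).
Proof. by split; exact: integrable0. Qed.

Lemma cintegral0 : cintegral mu (fun=> 0) = 0.
Proof.
rewrite -[RHS](mul0r (cintegral mu (fun=> 0))) -cintegralZl; last exact: cintegrable0.
by congr cintegral; apply/funext => x; rewrite mul0r.
Qed.

Lemma cintegrable_sum I (s : seq I) (h : I -> X -> R[i]) :
  (forall i, cintegrable (h i)) -> cintegrable (fun x => \sum_(i <- s) h i x).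
Proof.
move=> hi; elim: s => [|i s ih].
  by under eq_fun do rewrite big_nil; exact: cintegrable0.
by under eq_fun do rewrite big_cons; exact: cintegrableD.
Qed.

Lemma cintegral_sum I (s : seq I) (h : I -> X -> R[i]) :
  (forall i, cintegrable (h i)) ->
  cintegral mu (fun x => \sum_(i <- s) h i x) = \sum_(i <- s) cintegral mu (h i).
Proof.
move=> hi; elim: s => [|i s ih].
  by under eq_fun do rewrite big_nil; rewrite big_nil cintegral0.
under eq_fun do rewrite big_cons; rewrite big_cons -ih cintegralD//.
exact: cintegrable_sum.
Qed.

Lemma cintegral_conj f : cintegrable f ->
  cintegral mu (fun x => conjc (f x)) = conjc (cintegral mu f).
Proof.
move=> [fr fi]; apply/eqP; rewrite eq_complex /=; apply/andP; split.
  by under eq_Rintegral do rewrite Re_conjc.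
under eq_Rintegral do rewrite Im_conjc -mulN1r.
by rewrite RintegralZl// mulN1r.
Qed.

Lemma ae_eq_cintegral f g : cmeasurable f -> cmeasurable g ->
  {ae mu, forall x, f x = g x} -> cintegral mu f = cintegral mu g.
Proof.
move=> [fr fi] [gr gi] fg; apply/eqP; rewrite eq_complex /=; apply/andP; split;
  apply/eqP; congr fine; apply: ae_eq_integral => //; try exact/measurable_EFinP.
  by apply: filterS fg => x -> .
by apply: filterS fg => x -> .
Qed.

Lemma cmeasurableM f g : cmeasurable f -> cmeasurable g ->
  cmeasurable (fun x => f x * g x).
Proof.
move=> [fr fi] [gr gi]; split.
  by under eq_fun do rewrite Re_mul; apply: measurable_funB; apply: measurable_funM.
by under eq_fun do rewrite Im_mul; apply: measurable_funD; apply: measurable_funM.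
Qed.

Lemma cmeasurableX f k : cmeasurable f -> cmeasurable (fun x => f x ^+ k).
Proof.
move=> mf; elim: k => [|k ih]; first by split; exact: measurable_cst.
by under eq_fun do rewrite exprS; exact: cmeasurableM.
Qed.

Lemma cintegrable_cmeasurable f : cintegrable f -> cmeasurable f.
Proof.
by move=> [/integrableP[/measurable_EFinP ? _] /integrableP[/measurable_EFinP ? _]].
Qed.

Lemma cmeasurable_conj f : cmeasurable f -> cmeasurable (fun x => conjc (f x)).
Proof.
move=> [fr fi]; split; first by under eq_fun do rewrite Re_conjc.
by under eq_fun do rewrite Im_conjc; exact: measurableT_comp.
Qed.

Lemma cintegrable_bounded f (M : R) : (mu setT < +oo)%E -> cmeasurable f ->
  (forall x, `|f x| <= M%:C%C) -> cintegrable f.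
Proof.
move=> fin [fr fi] fM; split; apply: measurable_bounded_integrable => //;
  exists M; (split=> [|y My x _]; first exact: num_real);
  rewrite /= -lecR; (apply: le_trans (_ : `|f x| <= _)).
- exact: normc_ge_Re.
- by rewrite (le_trans (fM x))// lecR ltW.
- exact: normc_ge_Im.
- by rewrite (le_trans (fM x))// lecR ltW.
Qed.

End complex_integral.

(** * The inner product of [L2 nu] *)

Section L2_inner_product.
Context d (X : measurableType d) (R : realType).
Variable nu : {measure set X -> \bar R}.
Implicit Types (f g : L2fun nu) (u v w : L2 nu) (a : R[i]).

Local Open Scope quotient_scope.

Lemma cmeasurable_L2fun f : cmeasurable (val f).
Proof. by have /asboolP[] := valP f. Qed.

Lemma integrable_normc2 f :
  nu.-integrable setT (EFin \o (fun x => Normc.normc (val f x) ^+ 2)).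
Proof.
have /asboolP[mf ff] := valP f; apply/integrableP; split.
  exact: measurable_normc2.
under eq_integral do rewrite /= ger0_norm ?sqr_ge0//.
exact: ff.
Qed.

(** Each part of the integrand is dominated by [|f|^2 + |g|^2], by expanding squares of sums and
    differences of the parts of [f] and [g]. *)
Lemma cintegrable_mul_conj f g :
  cintegrable nu (fun x => val f x * conjc (val g x)).
Proof.
have [m1 m2] : cmeasurable (fun x => val f x * conjc (val g x)).
  by apply: cmeasurableM; [|apply: cmeasurable_conj]; exact: cmeasurable_L2fun.
have i := integrableD measurableT (integrable_normc2 f) (integrable_normc2 g).
split; apply: (le_integrable measurableT _ _ i); try exact/measurable_EFinP;
  move=> x _; rewrite /= lee_fin; apply: le_trans (ler_norm _); rewrite !normc2E.
- rewrite Re_mul Re_conjc Im_conjc; move: (val f x) (val g x) => [a b] [r s] /=.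
  have [] := (sqr_ge0 (a + r), sqr_ge0 (a - r)).
  have [] := (sqr_ge0 (b + s), sqr_ge0 (b - s)).
  by rewrite ler_norml => ? ? ? ?; apply/andP; split; lra.
- rewrite Im_mul Re_conjc Im_conjc; move: (val f x) (val g x) => [a b] [r s] /=.
  have [] := (sqr_ge0 (a + s), sqr_ge0 (a - s)).
  have [] := (sqr_ge0 (b + r), sqr_ge0 (b - r)).
  by rewrite ler_norml => ? ? ? ?; apply/andP; split; lra.
Qed.

(** [dotL2] integrates chosen representatives; these agree almost everywhere with [f] and [g].
    Identities for the inner product can then be checked pointwise. *)
Lemma dotL2_pi f g : dotL2 (\pi_(L2 nu) f) (\pi_(L2 nu) g) =
  cintegral nu (fun x => val f x * conjc (val g x)).
Proof.
have mL h := cmeasurable_L2fun h.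
have rE h : {ae nu, forall x, val (repr (\pi_(L2 nu) h)) x = val h x}.
  by apply/eq_L2; rewrite reprK.
apply: ae_eq_cintegral; try by apply: cmeasurableM; [|apply: cmeasurable_conj].
by apply: filterS2 (rE f) (rE g) => x -> ->.
Qed.

Lemma scale_piE a f : a *: \pi_(L2 nu) f = \pi_(L2 nu) (a *: f).
Proof. exact: pi_scaleL2. Qed.

Lemma dotL2Dl u v w : dotL2 (u + v) w = dotL2 u w + dotL2 v w.
Proof.
elim/quotW: u => f; elim/quotW: v => g; elim/quotW: w => h.
rewrite -raddfD !dotL2_pi -cintegralD; try exact: cintegrable_mul_conj.
congr cintegral; apply/funext => x.
by rewrite -mulrDl.
Qed.

Lemma dotL2Zl a u w : dotL2 (a *: u) w = a * dotL2 u w.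
Proof.
elim/quotW: u => f; elim/quotW: w => h.
rewrite scale_piE !dotL2_pi -cintegralZl; last exact: cintegrable_mul_conj.
congr cintegral; apply/funext => x.
by rewrite mulrA.
Qed.

Lemma dotL2_conj u v : dotL2 u v = conjc (dotL2 v u).
Proof.
elim/quotW: u => f; elim/quotW: v => g.
rewrite !dotL2_pi -cintegral_conj; last exact: cintegrable_mul_conj.
by congr cintegral; apply/funext => x; rewrite conjcM conjcK mulrC.
Qed.

Lemma dotL2Dr u v w : dotL2 w (u + v) = dotL2 w u + dotL2 w v.
Proof. by rewrite dotL2_conj dotL2Dl conjcD -!dotL2_conj. Qed.

Lemma dotL2Zr a u w : dotL2 w (a *: u) = conjc a * dotL2 w u.
Proof. by rewrite dotL2_conj dotL2Zl conjcM -dotL2_conj. Qed.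

Lemma dotL2Bl u v w : dotL2 (u - v) w = dotL2 u w - dotL2 v w.
Proof. by rewrite -scaleN1r dotL2Dl dotL2Zl mulN1r. Qed.

Lemma dotL20 v : dotL2 0 v = 0.
Proof. by rewrite -(scale0r v) dotL2Zl mul0r. Qed.

Lemma dotL2_suml I (s : seq I) (F : I -> L2 nu) v :
  dotL2 (\sum_(i <- s) F i) v = \sum_(i <- s) dotL2 (F i) v.
Proof.
by elim/big_rec2: _ => [|i x y _ <-]; rewrite ?dotL20 ?dotL2Dl.
Qed.

Lemma dotL2_sumr I (s : seq I) (F : I -> L2 nu) v :
  dotL2 v (\sum_(i <- s) F i) = \sum_(i <- s) dotL2 v (F i).
Proof.
by rewrite dotL2_conj dotL2_suml conjc_sum; apply: eq_bigr => i _; rewrite -dotL2_conj.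
Qed.

Lemma dotL2_ge0 v : 0 <= dotL2 v v.
Proof.
(* In [R[i]] the relation [0 <= z] also says that [z] is real, whence two goals. *)
elim/quotW: v => f; rewrite dotL2_pi lecE /=; apply/andP; split.
  rewrite (_ : (fun _ => _) = cst 0) ?Rintegral_cst ?mul0r//.
  by apply/funext => x; rewrite Im_mul Re_conjc Im_conjc mulrN mulrC addrC mulrC subrr.
apply: Rintegral_ge0 => x _; rewrite Re_mul Re_conjc Im_conjc mulrN opprK.
by rewrite addr_ge0 ?sqr_ge0.
Qed.

Lemma dotL2_eq0 v : dotL2 v v = 0 -> v = 0.
Proof.
elim/quotW: v => f; rewrite dotL2_pi => /(congr1 (@complex.Re R)).
rewrite (_ : complex.Re _ =
    fine (\int[nu]_x (Normc.normc (val f x) ^+ 2)%:E)%E); last first.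
  rewrite /=; congr fine; apply: eq_integral => x _.
  by rewrite Re_mul Re_conjc Im_conjc mulrN opprK normc2E.
(* [fine] sends infinite values to 0 as well, so finiteness of the integral is needed to conclude
   that it vanishes. *)
move=> /= /eqP; rewrite fine_eq0; last first.
  by apply: integrable_fin_num => //; exact: integrable_normc2.
move=> /eqP i0; rewrite -[RHS](raddf0 \pi_(L2 nu)); apply/eq_L2.
have [+ _] := ae_eq_integral_abs nu measurableT
  (measurable_normc2 (cmeasurable_L2fun f)).
under eq_integral do rewrite /= ger0_norm ?sqr_ge0//.
move=> /(_ i0); apply: filterS => x /(_ I) /= [] /eqP.
by rewrite sqrf_eq0 => /eqP/Normc.eq0_normc.
Qed.

End L2_inner_product.

(** * The Koopman operator is linear and isometric *)

Section koopman_isometry.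
Context d (X : measurableType d) (R : realType).
Variables (nu : {measure set X -> \bar R}) (T : X -> X).
Hypothesis hT : invertible_measure_preserving nu T.

Local Open Scope quotient_scope.

(** The exceptional null set is pulled back by [T] to a set of the same measure. This makes
    composition with [T] well defined on classes. *)
Lemma ae_comp (P : set X) : {ae nu, forall x, P x} -> {ae nu, forall x, P (T x)}.
Proof.
have [mT _ Tnu] := hT => -[A [mA A0 PA]]; exists (T @^-1` A); split.
- by rewrite -[_ @^-1` _]setTI; exact: mT.
- by rewrite Tnu.
- by move=> x /= nP; apply: PA.
Qed.

Lemma koopman_pi (f : L2fun nu) : koopman hT (\pi_(L2 nu) f) =
  \pi_(L2 nu) (Sub (val f \o T) (in_L2_comp hT (valP f))).
Proof.
have fE : {ae nu, forall x, val (repr (\pi_(L2 nu) f)) x = val f x}.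
  by apply/eq_L2; rewrite reprK.
rewrite /koopman; apply/eq_L2; exact: (ae_comp fE).
Qed.

Lemma koopman_linear : linear (koopman hT).
Proof.
move=> a; elim/quotW=> f; elim/quotW=> g.
rewrite scale_piE -raddfD !koopman_pi scale_piE -raddfD.
by congr (\pi_(L2 nu) _); apply/val_inj; rewrite !SubK.
Qed.

(** For nonnegative functions this is integration against the pushforward of [nu], which equals
    [nu]; the general case splits [h] into positive and negative parts. *)
Lemma Rintegral_comp (h : X -> R) : nu.-integrable setT (EFin \o h) ->
  \int[nu]_x h (T x) = \int[nu]_x h x.
Proof.
have [mT _ Tnu] := hT => ih.
have mh : measurable_fun setT h by apply/measurable_EFinP; case/integrableP: ih.
have Epush (g : X -> \bar R) : measurable_fun setT g -> (forall x, 0 <= g x)%E ->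
    (\int[nu]_x g (T x) = \int[nu]_x g x)%E.
  move=> mg g0; rewrite -[LHS](@ge0_integral_pushforward _ _ _ _ _ _ mT nu setT)//.
  by apply: eq_measure_integral => A mA _; exact: Tnu.
congr fine; rewrite integralE [RHS]integralE; congr (_ - _)%E.
  rewrite -(Epush ((fun y => (h y)%:E)^\+)%E)//.
    by apply: eq_integral => x _; rewrite !funeposE.
  by apply: measurable_funepos; exact/measurable_EFinP.
rewrite -(Epush ((fun y => (h y)%:E)^\-)%E)//.
  by apply: eq_integral => x _; rewrite !funenegE.
by apply: measurable_funeneg; exact/measurable_EFinP.
Qed.

Lemma koopman_isometry u v : dotL2 (koopman hT u) (koopman hT v) = dotL2 u v.
Proof.
elim/quotW: u => f; elim/quotW: v => g; rewrite !koopman_pi !dotL2_pi !SubK.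
have [ir ii] := cintegrable_mul_conj f g.
apply/eqP; rewrite eq_complex /=.
by rewrite (Rintegral_comp ir) (Rintegral_comp ii) !eqxx.
Qed.

End koopman_isometry.

(** * Finite partitions of the circle into small cells *)

Lemma bounded_finite_fibers d (Y : measurableType d) (R : realType)
    (g : Y -> R) (M e : R) :
  measurable_fun setT g -> (forall y, `|g y| <= M) -> 0 < e ->
  exists m (t : Y -> 'I_m.+1), (forall k, measurable [set y | t y = k]) /\
    forall y y', t y = t y' -> `|g y - g y'| <= e.
Proof.
(* Shifting by [M] and dividing by [e] puts the values in [[0, 2 * M / e]]; the cells are the
   preimages of the unit intervals [[k, k+1)]. *)
move=> mg gM e0; pose h y := (g y + M) / e.
have h0 y : 0 <= h y.
  by rewrite divr_ge0 ?(ltW e0)//; have := gM y; rewrite ler_norml => /andP[]; lra.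
exists (Num.truncn (2 * M / e)), (fun y => inord (Num.truncn (h y))).
(* The truncation never exceeds the largest ordinal, so [inord] does not fall back on its
   default. *)
have hk y k : inord (Num.truncn (h y)) = k :> 'I_(Num.truncn (2 * M / e)).+1 <->
    k%:R <= h y < k.+1%:R.
  rewrite -truncn_eq//; split=> [<-|/eqP tk]; last by rewrite tk inord_val.
  rewrite inordK// ltnS le_truncn// ler_pM2r ?invr_gt0//.
  by have := gM y; rewrite ler_norml => /andP[]; lra.
have mh : measurable_fun setT h.
  by apply: measurable_funM => //; exact: measurable_funD.
split=> [k|y y' E].
  rewrite (_ : [set _ | _] = setT `&` h @^-1` `[k%:R, k.+1%:R[); first exact: mh.
  by rewrite setTI; apply/seteqP; split=> y /=; rewrite in_itv /= hk.
move: E => /hk.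
have /hk := erefl (inord (Num.truncn (h y')) : 'I_(Num.truncn (2 * M / e)).+1).
move: (nat_of_ord _) => k; rewrite /h !ler_pdivlMr ?ltr_pdivrMr// -natr1.
move=> /andP[a b] /andP[c f]; rewrite ler_norml; apply/andP; split; lra.
Qed.

Section circle.
Variable R : realType.

Lemma cmeasurable_circle : cmeasurable (fun z : circle R => val z).
Proof.
have mc : measurable_fun setT (@circle_coord R : circle R -> _).
  by move=> _ A mA; exists A.
split.
  exact: (measurableT_comp measurable_fst mc).
exact: (measurableT_comp measurable_snd mc).
Qed.

Lemma norm_circle (z : circle R) : `|val z| = 1.
Proof. exact/eqP/(valP z). Qed.

Lemma norm_Re_circle (z : circle R) : `|complex.Re (val z)| <= 1.
Proof.
by rewrite -lecR (le_trans (normc_ge_Re _))// norm_circle.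
Qed.

Lemma norm_Im_circle (z : circle R) : `|complex.Im (val z)| <= 1.
Proof.
by rewrite -lecR (le_trans (normc_ge_Im _))// norm_circle.
Qed.

(** A cell is the intersection of a vertical and a horizontal strip of width [e / 2], and the
    modulus is at most the sum of the moduli of the parts. [get] picks a sample point in each
    nonempty cell; an empty cell receives the default point, which still has modulus 1. *)
Lemma circle_partition (e : R) : 0 < e -> exists (J : finType) (t : circle R -> J)
    (c : J -> circle R), (forall j, measurable [set z | t z = j]) /\
  forall z, `|val z - val (c (t z))| <= e%:C%C.
Proof.
move=> e0; have e2 : 0 < e / 2 by rewrite divr_gt0.
have [mR mI] := cmeasurable_circle.
have [m [t [mt td]]] := bounded_finite_fibers mR norm_Re_circle e2.
have [n [s [ms sd]]] := bounded_finite_fibers mI norm_Im_circle e2.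
pose r z := (t z, s z).
exists ('I_m.+1 * 'I_n.+1)%type, r, (fun j => get [set z | r z = j]); split.
  move=> [j k]; rewrite (_ : [set _ | _] = [set z | t z = j] `&` [set z | s z = k]).
    exact: measurableI.
  by apply/seteqP; split=> z; rewrite /r /= => -[-> ->].
move=> z; have [] : r (get [set w | r w = r z]) = r z.
  exact: (@getI _ [set w | r w = r z] z).
move: (get _) => w /esym/td tw /esym/sd sw.
apply: le_trans (normc_ReIm _) _; rewrite lecR.
move: tw sw; case: (val z) (val w) => [a b] [a' b'] /=; lra.
Qed.

End circle.

(** * From quadratic forms to sesquilinear forms *)

Section numerical_radius.
Context d (X : measurableType d) (R : realType).
Variable nu : {measure set X -> \bar R}.
Implicit Types (u v w : L2 nu).

(* Polarization: the four vectors [u + s v] with [s ^+ 4 = 1]. *)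
Lemma dotL2_polar_bound (D : L2 nu -> L2 nu) (K : R[i]) :
  linear D -> (forall w, `|dotL2 (D w) w| <= K * dotL2 w w) ->
  forall u v, `|dotL2 (D u) v| <= K * (dotL2 u u + dotL2 v v).
Proof.
move=> lD DK u v.
have E s : dotL2 (D (s *: v + u)) (s *: v + u) = s * conjc s * dotL2 (D v) v
    + s * dotL2 (D v) u + conjc s * dotL2 (D u) v + dotL2 (D u) u.
  by rewrite lD dotL2Dl !dotL2Zl !dotL2Dr !dotL2Zr; ring.
have F s : dotL2 (s *: v + u) (s *: v + u) = s * conjc s * dotL2 v v
    + s * dotL2 v u + conjc s * dotL2 u v + dotL2 u u.
  by rewrite dotL2Dl !dotL2Zl !dotL2Dr !dotL2Zr; ring.
pose i : R[i] := 'i%C.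
have ii : i * i = -1 by rewrite -sqr_i.
have ci : conjc i = - i by apply/eqP; rewrite eq_complex /= oppr0 !eqxx.
have c1 : conjc (1 : R[i]) = 1 by exact: conjc1.
have cN x : conjc (- x : R[i]) = - conjc x by exact: rmorphN.
have ni : `|i| = 1.
  by apply/eqP; rewrite -(@eqrXn2 _ 2)// sqr_normc ci mulrN ii opprK expr1n.
pose q s := dotL2 (D (s *: v + u)) (s *: v + u).
pose p s := dotL2 (s *: v + u) (s *: v + u).
have h : 4 * dotL2 (D u) v = q 1 - q (- 1) + i * q i - i * q (- i).
  by rewrite /q !E !cN c1 ci; ring: ii.
have hp : 4 * (dotL2 u u + dotL2 v v) = p 1 + p (- 1) + p i + p (- i).
  by rewrite /p !F !cN c1 ci; ring: ii.
have H : `|4 * dotL2 (D u) v| <= K * (4 * (dotL2 u u + dotL2 v v)).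
  rewrite h hp !mulrDr; apply: le_trans (ler_normB _ _) _.
  rewrite normrM ni mul1r lerD ?DK//; apply: le_trans (ler_normD _ _) _.
  rewrite normrM ni mul1r lerD ?DK//; apply: le_trans (ler_normB _ _) _.
  by rewrite lerD ?DK.
by move: H; rewrite normrM normr_nat mulrCA ler_pM2l ?ltr0n.
Qed.

End numerical_radius.

(** * Projection-valued measures and their step operators *)

Section spectral.
Context d (X : measurableType d) (R : realType).
Variable nu : {measure set X -> \bar R}.
Variable E : pvm nu.
Implicit Types (u v w g : L2 nu) (A B : set (circle R)).

Local Notation mu := (spectral_measure E).

Lemma pvm_linear A : measurable A -> linear (E A).
Proof. by move=> /(pvm_proj E)[]. Qed.

Lemma pvm_idem A u : measurable A -> E A (E A u) = E A u.
Proof. by move=> /(pvm_proj E)[_ + _]; apply. Qed.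

Lemma pvm_adj A u v : measurable A -> dotL2 (E A u) v = dotL2 u (E A v).
Proof. by move=> /(pvm_proj E)[_ _]; apply. Qed.

Lemma spectral_measureE g A : measurable A ->
  mu g A = (complex.Re (dotL2 (E A g) g))%:E.
Proof. by move=> mA; rewrite /spectral_measure mem_set. Qed.

(** As [E A] is a self-adjoint idempotent, [<E(A) g, g> = <E(A) g, E(A) g>] is real, so taking the
    real part in [spectral_measure] loses nothing. *)
Lemma dotL2_pvm g A : measurable A -> dotL2 (E A g) g = (fine (mu g A))%:C%C.
Proof.
move=> mA; rewrite spectral_measureE// -[fine _]/(complex.Re _) RRe_real//.
by rewrite -[E A g]pvm_idem// pvm_adj// ger0_real// dotL2_ge0.
Qed.

Lemma spectral_measureT g : (fine (mu g setT))%:C%C = dotL2 g g.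
Proof. by rewrite -dotL2_pvm// pvmT. Qed.

Lemma spectral_measureT_lty g : (mu g setT < +oo)%E.
Proof. by rewrite spectral_measureE// ltry. Qed.

(** The product is [E set0], which vanishes because [<E(set0) u, E(set0) u>] is the conjugate of the
    mass that the measure of [u] gives to the empty set. *)
Lemma pvm_disjoint A B u : measurable A -> measurable B -> A `&` B = set0 ->
  E A (E B u) = 0.
Proof.
move=> mA mB AB; rewrite -[LHS]/((E A \o E B) u) -pvmI// AB.
apply: dotL2_eq0; rewrite pvm_adj// pvm_idem// dotL2_conj dotL2_pvm//.
by rewrite measure0 conjc0.
Qed.

Lemma cintegral_indic g A : measurable A ->
  cintegrable (mu g) (fun z => (\1_A z)%:C%C) /\
  cintegral (mu g) (fun z => (\1_A z)%:C%C) = dotL2 (E A g) g.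
Proof.
move=> mA; split.
  split; last exact: integrable0.
  apply: measurable_bounded_integrable => //.
  - exact: spectral_measureT_lty.
  - exact: measurable_indic.
  exists 1; split=> // y y1 x _; rewrite /= (le_trans _ (ltW y1))//.
  by rewrite indicE; case: (_ \in _); rewrite ?normr1 ?normr0.
rewrite dotL2_pvm//; apply/eqP; rewrite eq_complex /= Rintegral_cst// mul0r eqxx andbT.
by rewrite /Rintegral integral_indic// setIT.
Qed.

(** Real and imaginary parts are each bounded by [e] times the total mass [<g, g>], hence the factor
    2. *)
Lemma norm_cintegral_le g (h : circle R -> R[i]) (e : R) :
  cmeasurable h -> (forall z, `|h z| <= e%:C%C) ->
  `|cintegral (mu g) h| <= (e *+ 2)%:C%C * dotL2 g g.
Proof.
move=> mh he; have muoo := spectral_measureT_lty g.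
have [ir ii] := cintegrable_bounded muoo mh he.
have hR z : `|complex.Re (h z)| <= e by rewrite -lecR (le_trans (normc_ge_Re _)).
have hI z : `|complex.Im (h z)| <= e.
  by rewrite -lecR (le_trans _ (he z))// normc_ge_Im.
have bnd (k : circle R -> R) : (forall z, `|k z| <= e) ->
    (mu g).-integrable setT (EFin \o k) -> `|\int[mu g]_z k z| <= e * fine (mu g setT).
  move=> ke ik; apply: le_trans (le_normr_Rintegral _ ik) _ => //.
  rewrite -Rintegral_cst//; apply: le_Rintegral => //; first exact: integrable_norm.
  apply: measurable_bounded_integrable => //; exact: bounded_cst.
apply: le_trans (normc_ReIm _) _.
rewrite -spectral_measureT -rmorphM lecR mulr2n mulrDl.
by apply: lerD; exact: bnd.
Qed.

Section finite_partition.
Variables (J : finType) (t : circle R -> J).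
Hypothesis mt : forall j, measurable [set z | t z = j].
Implicit Types b c : J -> R[i].

(** This is the integral of the step function [c \o t] against [E]; the cells are the fibres of
    [t]. *)
Definition step_op c (u : L2 nu) : L2 nu :=
  \sum_j c j *: E [set z | t z = j] u.

Lemma step_op_linear c : linear (step_op c).
Proof.
move=> a u v; rewrite /step_op scaler_sumr -big_split; apply: eq_bigr => j _ /=.
by rewrite pvm_linear// scalerDr !scalerA mulrC.
Qed.

Lemma step_op_adj c u v :
  dotL2 (step_op c u) v = dotL2 u (step_op (fun j => conjc (c j)) v).
Proof.
rewrite dotL2_suml dotL2_sumr; apply: eq_bigr => j _.
by rewrite dotL2Zl dotL2Zr conjcK pvm_adj.
Qed.

(** The cells are disjoint, so the cross terms vanish and the diagonal ones are idempotent. This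
    gives access to the powers of a step operator. *)
Lemma step_op_mul b c u : step_op b (step_op c u) = step_op (fun j => b j * c j) u.
Proof.
apply: eq_bigr => j _; rewrite /step_op (linear_sum_scale _ _ _ (pvm_linear (mt j))).
rewrite (bigD1 j)//= big1 ?addr0; first by rewrite pvm_idem// scalerA.
move=> i ij; rewrite pvm_disjoint ?scaler0//.
by apply/seteqP; split=> // z [/= zj zi]; move: ij; rewrite -zj -zi eqxx.
Qed.

Lemma step_fun_sum c (z : circle R) :
  c (t z) = \sum_j c j * (\1_[set z | t z = j] z)%:C%C.
Proof.
rewrite (bigD1 (t z))//= big1 ?addr0 ?indicE ?mem_set ?mulr1//.
move=> j jz; rewrite indicE memNset ?mulr0// => /= /esym/eqP.
by rewrite (negPf jz).
Qed.

Lemma cintegrable_step g c : cintegrable (mu g) (fun z => c (t z)).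
Proof.
under eq_fun do rewrite step_fun_sum.
apply: cintegrable_sum => j; apply: cintegrableZl.
by have [] := cintegral_indic g (mt j).
Qed.

Lemma dotL2_step_op g c :
  dotL2 (step_op c g) g = cintegral (mu g) (fun z => c (t z)).
Proof.
have ci j := cintegral_indic g (mt j).
under [X in cintegral _ X]eq_fun do rewrite step_fun_sum.
rewrite cintegral_sum; last by move=> j; apply: cintegrableZl; case: (ci j).
rewrite dotL2_suml; apply: eq_bigr => j _.
by case: (ci j) => h1 h2; rewrite dotL2Zl cintegralZl// h2.
Qed.

(** The adjoint has the conjugate coefficients, so composing it with the operator gives coefficients
    [|c_j|^2 = 1], whose form is the total mass. *)
Lemma step_op_isometry c g : (forall j, `|c j| = 1) ->
  dotL2 (step_op c g) (step_op c g) = dotL2 g g.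
Proof.
move=> c1; rewrite dotL2_conj step_op_adj step_op_mul -dotL2_conj dotL2_step_op.
under [X in cintegral _ X]eq_fun do rewrite mulrC -sqr_normc c1 expr1n.
have [_] := cintegral_indic g measurableT.
by rewrite pvmT indicT.
Qed.

Lemma dotL2_iter_step_op c g k :
  dotL2 (iter k (step_op c) g) g = cintegral (mu g) (fun z => c (t z) ^+ k).
Proof.
(* The zeroth iterate is [g] itself and not a [step_op], so it is matched with the total mass
   directly. *)
case: k => [|k].
  under [X in cintegral _ X]eq_fun do rewrite expr0.
  have [_] := cintegral_indic g measurableT.
  by rewrite pvmT indicT => <-.
rewrite (_ : iter _ _ _ = step_op (fun j => c j ^+ k.+1) g) ?dotL2_step_op//.
elim: k => [|k ih]; first by congr step_op; apply/funext.
by rewrite iterS ih step_op_mul; congr step_op; apply/funext => j; rewrite -exprS.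
Qed.

End finite_partition.
End spectral.

(** * Moments of the spectral measure *)

Lemma norm_expB_le (C : numDomainType) (z w : C) k : `|z| = 1 -> `|w| = 1 ->
  `|z ^+ k - w ^+ k| <= `|z - w| *+ k.
Proof.
move=> z1 w1; elim: k => [|k ih]; first by rewrite subrr normr0.
rewrite (_ : _ - _ = z ^+ k * (z - w) + (z ^+ k - w ^+ k) * w); last first.
  by rewrite mulrBr mulrBl -!exprSr addrA subrK.
apply: le_trans (ler_normD _ _) _.
by rewrite !normrM normrX z1 w1 expr1n mul1r mulr1 mulrS lerD2l.
Qed.

(** This chooses the mesh [e'] that brings the error of [moment_near], for total mass [m], below
    [e]. The [+ 1] in [b] keeps it positive when [k] or [m] is 0. *)
Lemma small_multiple (F : realFieldType) (m e : F) k : 0 <= m -> 0 < e ->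
  exists2 e', 0 < e' & e' *+ 6 *+ k * m <= e.
Proof.
move=> m0 e0; pose b := 6 * k%:R * m + 1.
have b0 : 0 < b by rewrite ltr_wpDl// !mulr_ge0.
exists (e / b); first by rewrite divr_gt0.
have -> : e / b *+ 6 *+ k * m = e * ((b - 1) / b).
  by rewrite /b -[e / _ *+ 6 *+ k]mulr_natr; ring.
by rewrite ger_pMr// ler_pdivrMr// mul1r gerDl lerN10.
Qed.

Section moments.
Context d (X : measurableType d) (R : realType).
Variable nu : {measure set X -> \bar R}.
Variables (E : pvm nu) (U : L2 nu -> L2 nu).
Hypothesis linU : linear U.
Hypothesis isoU : forall u v, dotL2 (U u) (U v) = dotL2 u v.
Hypothesis specU : is_spectral_measure_of U E.
Implicit Types (u v w g : L2 nu).

Local Notation mu := (spectral_measure E).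

Lemma iter_isometry k u v : dotL2 (iter k U u) (iter k U v) = dotL2 u v.
Proof. by elim: k => //= k ih; rewrite isoU. Qed.

Section step_approximation.
Variables (J : finType) (t : circle R -> J) (c : J -> circle R) (e : R).
Hypothesis mt : forall j, measurable [set z | t z = j].
Hypothesis ct : forall z, `|val z - val (c (t z))| <= e%:C%C.

Let S := step_op E t (fun j => val (c j)).
Let K : R[i] := (e *+ 2)%:C%C.

(** This is where [specU] enters: the form of [U - S] is the integral of [val z - val (c (t z))],
    whose modulus is at most [e]. *)
Lemma step_op_form g : `|dotL2 (U g - S g) g| <= K * dotL2 g g.
Proof.
have cs := cintegrable_step E mt g (fun j => val (c j)).
rewrite dotL2Bl specU dotL2_step_op// -mulN1r -cintegralZl; last exact: cs.
have cv : cintegrable (mu g) (fun z => val z).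
  apply: (cintegrable_bounded (M := 1)); [exact: spectral_measureT_lty| |].
    exact: cmeasurable_circle.
  by move=> z; rewrite norm_circle.
rewrite -cintegralD//; last exact: cintegrableZl.
apply: norm_cintegral_le => [|z]; last by rewrite mulN1r.
apply: cintegrable_cmeasurable; exact: cintegrableD cv (cintegrableZl (-1) cs).
Qed.

Lemma step_op_near u v : `|dotL2 (U u - S u) v| <= K * (dotL2 u u + dotL2 v v).
Proof.
apply: (dotL2_polar_bound (D := fun u => U u - S u)); last exact: step_op_form.
move=> a x y; rewrite linU [S _]step_op_linear// scalerBr.
by rewrite opprD addrACA.
Qed.

(** Write [U^(k+1) - S^(k+1) = (U - S) U^k + S (U^k - S^k)]. In the first term [U^k f] has the norm
    of [f]; in the second, [S] moves to the other side as its adjoint, which preserves the norm of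
    [v]. The induction therefore needs [v] to vary. *)
Lemma iter_step_op_near f k v : `|dotL2 (iter k U f) v - dotL2 (iter k S f) v| <=
  K *+ k * (dotL2 f f + dotL2 v v).
Proof.
elim: k v => [|k ih] v; first by rewrite subrr normr0 mul0r.
pose Sv := step_op E t (fun j => conjc (val (c j))) v.
have -> : dotL2 (iter k.+1 U f) v - dotL2 (iter k.+1 S f) v =
    dotL2 (U (iter k U f) - S (iter k U f)) v +
    (dotL2 (iter k U f) Sv - dotL2 (iter k S f) Sv).
  by rewrite dotL2Bl -!step_op_adj// addrA subrK.
have nSv : dotL2 Sv Sv = dotL2 v v.
  by rewrite step_op_isometry// => j; rewrite normcJ norm_circle.
apply: le_trans (ler_normD _ _) _; rewrite mulrS mulrDl lerD//.
  by rewrite -(iter_isometry k f f) step_op_near.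
by rewrite -nSv ih.
Qed.

Lemma moment_near f k :
  `|dotL2 (iter k U f) f - cintegral (mu f) (fun z => val z ^+ k)| <=
  (e *+ 6 *+ k)%:C%C * dotL2 f f.
Proof.
have cv : cintegrable (mu f) (fun z => val z ^+ k).
  apply: (cintegrable_bounded (M := 1)); [exact: spectral_measureT_lty| |].
    by apply: cmeasurableX; exact: cmeasurable_circle.
  by move=> z; rewrite normrX norm_circle expr1n.
have cs := cintegrable_step E mt f (fun j => val (c j) ^+ k).
have -> : dotL2 (iter k U f) f - cintegral (mu f) (fun z => val z ^+ k) =
    (dotL2 (iter k U f) f - dotL2 (iter k S f) f) +
    cintegral (mu f) (fun z => val (c (t z)) ^+ k + -1 * val z ^+ k).
  rewrite dotL2_iter_step_op// cintegralD//; last exact: cintegrableZl.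
  by rewrite cintegralZl// mulN1r addrA subrK.
apply: le_trans (ler_normD _ _) _.
(* The integrands differ by at most [e *+ k], which costs [2k]; the operator estimate at [v = f] has
   [K = e *+ 2] and the factor [2 <f, f>], which costs [4k]. *)
rewrite (_ : e *+ 6 *+ k = e *+ k *+ 2 + e *+ 2 *+ k *+ 2); last by ring.
rewrite rmorphD mulrDl addrC lerD//.
  apply: norm_cintegral_le => [|z].
    apply: cintegrable_cmeasurable; exact: cintegrableD cs (cintegrableZl (-1) cv).
  rewrite mulN1r (le_trans (norm_expB_le _ _ _)) ?norm_circle//.
  by rewrite rmorphMn lerMn2r distrC ct orbT.
rewrite (le_trans (iter_step_op_near _ _ _))// -mulr2n mulrnAr.
rewrite 2!rmorphMn -[X in X <= _]mulrnAl; exact: lexx.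
Qed.

End step_approximation.

(** Neither side depends on the partition, so refining it makes the modulus of their difference
    smaller than any positive real. *)
Lemma spectral_moment f k :
  cintegral (mu f) (fun z => val z ^+ k) = dotL2 (iter k U f) f.
Proof.
apply/esym/eqP; rewrite -subr_eq0 -normr_eq0; set a := `|_|.
have a0 : 0 <= a by exact: normr_ge0.
have aR : a = (complex.Re a)%:C%C by rewrite RRe_real// ger0_real.
have fR : dotL2 f f = (fine (mu f setT))%:C%C by rewrite spectral_measureT.
rewrite eq_le a0 andbT aR lecR.
have M0 : 0 <= fine (mu f setT) by rewrite fine_ge0.
apply/ler_addgt0Pr => e e0; rewrite add0r.
have [e' e'0 e'e] := small_multiple k M0 e0.
have [J [t [c [mt ct]]]] := circle_partition e'0.
by have := moment_near mt ct f k; rewrite -/a aR fR -rmorphM lecR => /le_trans; apply.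
Qed.

End moments.

(** * Matrices, characteristic polynomials and change of basis *)

Section bases.
Variables (K : fieldType) (W : lmodType K).
Implicit Types (V : set W) (L : W -> W).

Lemma lincomb_is_linear n (b : 'I_n -> W) : linear (lincomb b).
Proof.
move=> a u v; rewrite /lincomb scaler_sumr -big_split; apply: eq_bigr => i _ /=.
by rewrite !mxE scalerDl scalerA.
Qed.

HB.instance Definition _ n (b : 'I_n -> W) :=
  GRing.isLinear.Build K 'rV[K]_n W *:%R (lincomb b) (lincomb_is_linear b).

Lemma lincomb_delta n (b : 'I_n -> W) i : lincomb b (delta_mx 0 i) = b i.
Proof.
rewrite /lincomb (bigD1 i)//= big1 ?addr0 ?mxE ?eqxx ?scale1r// => j ji.
by rewrite mxE (negPf ji) andbF scale0r.
Qed.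

Lemma lincomb_mulmx n m (b : 'I_n -> W) (A : 'M[K]_(m, n)) c :
  lincomb b (c *m A) = lincomb (fun i => lincomb b (row i A)) c.
Proof.
by rewrite mulmx_sum_row linear_sum; apply: eq_bigr => i _; rewrite linearZ.
Qed.

Lemma lincomb_change n m (b : 'I_n -> W) (b' : 'I_m -> W) :
  (forall i, span_of b (b' i)) ->
  exists A : 'M[K]_(m, n), forall c, lincomb b' c = lincomb b (c *m A).
Proof.
move=> bb'; have /choice[c cE] i : exists c, lincomb b c = b' i.
  by have [c _ <-] := bb' i; exists c.
exists (\matrix_i c i) => a.
by rewrite lincomb_mulmx; congr lincomb; apply/funext => i; rewrite rowK cE.
Qed.

Lemma span_of_mem n (b : 'I_n -> W) i : span_of b (b i).
Proof. by exists (delta_mx 0 i); rewrite ?lincomb_delta. Qed.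

Lemma mulmx1_eq_size m n (A : 'M[K]_(m, n)) (B : 'M[K]_(n, m)) :
  A *m B = 1%:M -> B *m A = 1%:M -> m = n.
Proof.
by move=> /mulmx1_min mn /mulmx1_min nm; apply/eqP; rewrite eqn_leq mn.
Qed.

Lemma char_poly_conj n (A M B : 'M[K]_n) : A *m B = 1%:M ->
  char_poly (A *m M *m B) = char_poly M.
Proof.
move=> AB; rewrite /char_poly.
have -> : char_poly_mx (A *m M *m B) =
    map_mx polyC A *m char_poly_mx M *m map_mx polyC B.
  rewrite /char_poly_mx mulmxBr mulmxBl !map_mxM; congr (_ - _).
  by rewrite scalar_mxC -mulmxA -map_mxM AB map_mx1 mulmx1.
by rewrite !det_mulmx mulrAC -det_mulmx -map_mxM AB map_mx1 det1 mul1r.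
Qed.

(** [is_char_poly] speaks of every basis, but a change of basis only conjugates the matrix, so one
    basis suffices. *)
Lemma is_char_poly_basis V L n (b : 'I_n -> W) (M : 'M[K]_n) :
  basis_of_set V b -> (forall c, L (lincomb b c) = lincomb b (c *m M)) ->
  is_char_poly V L (char_poly M).
Proof.
move=> bV LM; split; first by exists n, b.
move=> m b' [injb' spanb']; have [injb spanb] := bV.
have [A AE] : exists A : 'M[K]_(m, n), forall c, lincomb b' c = lincomb b (c *m A).
  by apply: lincomb_change => i; rewrite spanb -spanb'; exact: span_of_mem.
have [B BE] : exists B : 'M[K]_(n, m), forall c, lincomb b c = lincomb b' (c *m B).
  by apply: lincomb_change => i; rewrite spanb' -spanb; exact: span_of_mem.
have AB : A *m B = 1%:M.
  apply/row_matrixP => i; rewrite row_mul; apply: injb'.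
  by rewrite -BE !rowE mulmx1 AE.
have BA : B *m A = 1%:M.
  apply/row_matrixP => i; rewrite row_mul; apply: injb.
  by rewrite -AE !rowE mulmx1 BE.
(* The transition matrices are rectangular until their being mutually inverse forces the two bases
   to have equal length. *)
have E := mulmx1_eq_size AB BA; subst m.
exists (A *m M *m B); last exact: char_poly_conj.
move=> i; rewrite -[b' i]lincomb_delta AE LM BE; congr lincomb.
by rewrite rowE !mulmxA.
Qed.

Lemma is_eigenvalue_basis V L n (b : 'I_n -> W) (M : 'M[K]_n) a :
  basis_of_set V b -> (forall c, L (lincomb b c) = lincomb b (c *m M)) ->
  root (char_poly M) a <-> is_eigenvalue V L a.
Proof.
move=> [injb spanb] LM; rewrite -eigenvalue_root_char; split.
  move=> /eigenvalueP[c cM c0]; exists (lincomb b c); split.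
  - by rewrite -spanb; exists c.
  - by apply: contra c0 => /eqP bc; apply/eqP/injb; rewrite bc linear0.
  - by rewrite LM cM linearZ.
move=> [u [Vu u0 Lu]]; move: Vu u0 Lu; rewrite -spanb => -[c _ <-] c0 Lc.
apply/eigenvalueP; exists c; first by apply: injb; rewrite -LM Lc linearZ.
by apply: contra c0 => /eqP ->; rewrite linear0.
Qed.

(** The companion matrix is restated at a free size [n], so that it can serve as a matrix of size
    [N] without a cast from [(size p).-1]. *)
Lemma char_poly_companion n (p : {poly K}) : size p = n.+1 -> p \is monic ->
  char_poly (\matrix_(i < n, j < n)
    if i.+1 == n then - p`_j else (i.+1 == j)%:R) = p.
Proof.
move=> sp mp; have En : n = (size p).-1 by rewrite sp.
rewrite -[RHS]companionmxK//; subst n.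
congr char_poly; apply/matrixP => i j; rewrite !mxE.
by case: (size p).-1 i j => [[]|m] i j.
Qed.

End bases.

(** * Orthogonal projection onto a finite span *)

Section projection.
Context d (X : measurableType d) (R : realType).
Variable nu : {measure set X -> \bar R}.

(** If [x] is the vector chosen by [xget], then [x - v] lies in the span and, being
    [(u - v) - (u - x)], is orthogonal to it, hence to itself. *)
Lemma proj_on_unique n (b : 'I_n -> L2 nu) (u v : L2 nu) :
  span_of b v -> (forall w, span_of b w -> dotL2 (u - v) w = 0) ->
  proj_on (span_of b) u = v.
Proof.
move=> Vv vP; rewrite /proj_on.
have [] : [set v | span_of b v /\ forall w, span_of b w -> dotL2 (u - v) w = 0]
  (xget 0 [set v | span_of b v /\ forall w, span_of b w -> dotL2 (u - v) w = 0]).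
  exact: (xgetPex _ (ex_intro _ v (conj Vv vP))).
move: (xget _ _) => x Vx xP; apply/eqP; rewrite -subr_eq0; apply/eqP.
have Vxv : span_of b (x - v).
  by case: Vx Vv => [c _ <-] [c' _ <-]; exists (c - c') => //; rewrite linearB.
apply: dotL2_eq0; rewrite {1}(_ : x - v = (u - v) - (u - x)).
  by rewrite dotL2Bl vP// xP// subrr.
by rewrite opprB [RHS]addrC addrA subrK.
Qed.

End projection.

(** * Krylov vectors as polynomials in [L2(mu_f)] *)

Section krylov_polynomials.
Context d (X : measurableType d) (R : realType).
Variable nu : {measure set X -> \bar R}.
Variables (E : pvm nu) (U : L2 nu -> L2 nu) (f : L2 nu).
Hypothesis linU : linear U.
Hypothesis isoU : forall u v, dotL2 (U u) (U v) = dotL2 u v.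
Hypothesis specU : is_spectral_measure_of U E.
Implicit Types (p q : {poly R[i]}).

Local Notation mu := (spectral_measure E f).

Lemma cintegrable_circle_monomial i j :
  cintegrable mu (fun z => val z ^+ i * conjc (val z) ^+ j).
Proof.
apply: (cintegrable_bounded (M := 1)); first exact: spectral_measureT_lty.
  apply: cmeasurableM; first by apply: cmeasurableX; exact: cmeasurable_circle.
  by apply: cmeasurableX; apply: cmeasurable_conj; exact: cmeasurable_circle.
by move=> z; rewrite normrM !normrX normcJ norm_circle !expr1n mulr1.
Qed.

(** On the circle [z] times its conjugate is 1, which cancels the common powers just as the isometry
    cancels common iterates of [U]; a moment remains. The case [i < j] follows by conjugation. *)
Lemma spectral_dot_iter i j : cintegral mu (fun z => val z ^+ i * conjc (val z) ^+ j) =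
  dotL2 (iter i U f) (iter j U f).
Proof.
have key k l : cintegral mu (fun z => val z ^+ (k + l) * conjc (val z) ^+ l) =
    dotL2 (iter (k + l) U f) (iter l U f).
  rewrite addnC iterD iter_isometry// -(spectral_moment linU isoU specU) addnC.
  congr cintegral; apply/funext => z.
  by rewrite exprD -mulrA -exprMn -sqr_normc norm_circle !expr1n mulr1.
have [ji|/ltnW ij] := leqP j i; first by rewrite -(subnK ji) key.
rewrite dotL2_conj -(subnK ij) -key -cintegral_conj.
  congr cintegral; apply/funext => z.
  by rewrite conjcM !conjcX conjcK mulrC.
exact: cintegrable_circle_monomial.
Qed.

(* [p(U) f] for [size p <= n]; the fixed length makes it linear in [p]. *)
Definition krylov_poly n p : L2 nu := \sum_(i < n) p`_i *: iter i U f.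

Lemma krylov_poly_linear n : linear (krylov_poly n).
Proof.
move=> a p q; rewrite /krylov_poly scaler_sumr -big_split; apply: eq_bigr => i _ /=.
by rewrite coefD coefZ scalerDl scalerA.
Qed.

HB.instance Definition _ n := GRing.isLinear.Build R[i] {poly R[i]} (L2 nu) *:%R
  (krylov_poly n) (krylov_poly_linear n).

(** This is the isometry [p |-> p(U) f], by expansion into monomials; the size bounds ensure that
    the truncation at [n] drops no coefficient. *)
Lemma dot_krylov_poly n p q : (size p <= n)%N -> (size q <= n)%N ->
  dotL2 (krylov_poly n p) (krylov_poly n q) = dot_poly mu p q.
Proof.
move=> pn qn; rewrite /dot_poly.
have -> : (fun z : circle R => p.[val z] * conjc q.[val z]) =
    (fun z => \sum_(i < n) \sum_(j < n) (p`_i * conjc q`_j) *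
       (val z ^+ i * conjc (val z) ^+ j)).
  apply/funext => z; rewrite !(horner_coef_wide _ pn) !(horner_coef_wide _ qn).
  rewrite conjc_sum mulr_suml; apply: eq_bigr => i _.
  rewrite mulr_sumr; apply: eq_bigr => j _.
  by rewrite conjcM conjcX mulrACA.
rewrite cintegral_sum; last first.
  move=> i; apply: cintegrable_sum => j; apply: cintegrableZl.
  exact: cintegrable_circle_monomial.
rewrite dotL2_suml; apply: eq_bigr => i _.
rewrite cintegral_sum; last first.
  by move=> j; apply: cintegrableZl; exact: cintegrable_circle_monomial.
rewrite dotL2_sumr; apply: eq_bigr => j _.
rewrite cintegralZl; last exact: cintegrable_circle_monomial.
by rewrite spectral_dot_iter dotL2Zl dotL2Zr mulrA.
Qed.

Lemma lincomb_krylov n (c : 'rV[R[i]]_n) :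
  lincomb (fun i : 'I_n => iter i U f) c = krylov_poly n (rVpoly c).
Proof. by apply: eq_bigr => i _; rewrite coef_rVpoly_ord. Qed.

(** This lets polynomials of degree below [N] be paired with [Phi N], which has [N.+1]
    coefficients. *)
Lemma krylov_poly_widen n m p : (size p <= n)%N -> (n <= m)%N ->
  krylov_poly m p = krylov_poly n p.
Proof.
move=> pn nm; rewrite /krylov_poly.
rewrite (big_ord_widen_cond m predT (fun i => p`_i *: iter i U f) nm).
rewrite [RHS]big_mkcond; apply: eq_bigr => i _ /=; case: ltnP => // ni.
by rewrite nth_default ?scale0r// (leq_trans pn).
Qed.

Section orthogonal.
Variables (N : nat) (Phi : nat -> {poly R[i]}).
Hypothesis hPhi : orthogonal_polynomials mu N Phi.

Local Notation b := (fun i : 'I_N => iter i U f).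

Let monicPhi k : (k <= N)%N -> Phi k \is monic.
Proof. by case: hPhi => -[h _] _ /h[]. Qed.
Let sizePhi k : (k <= N)%N -> size (Phi k) = k.+1.
Proof. by case: hPhi => -[h _] _ /h[]. Qed.

Lemma krylov_free : injective (lincomb b).
Proof.
suff h c : lincomb b c = 0 -> c = 0.
  move=> x y xy; apply/eqP; rewrite -subr_eq0; apply/eqP/h.
  by rewrite linearB /= xy subrr.
rewrite lincomb_krylov => pc0; set p := rVpoly c in pc0.
have sp : (size p <= N)%N by exact: size_poly.
(* Adding [p] keeps the top member monic of degree [N], and no inner product changes because
   [p(U) f = 0]. *)
pose Psi k := if k == N then Phi N + p else Phi k.
have [[_ oPhi] uPhi] := hPhi.
have sPsi k : (k <= N)%N -> size (Psi k) = k.+1.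
  move=> kN; rewrite /Psi; case: eqVneq => [->|_]; last exact: sizePhi.
  by rewrite size_polyDl sizePhi// ltnS.
have kPsi k : krylov_poly N.+1 (Psi k) = krylov_poly N.+1 (Phi k).
  rewrite /Psi; case: eqVneq => [->|//].
  by rewrite linearD /= (krylov_poly_widen (m := N.+1) sp)// pc0 addr0.
have : Psi N = Phi N.
  apply: uPhi => //; split=> [k kN|j k jN kN jk].
    split; last exact: sPsi.
    rewrite /Psi; case: eqVneq => [_|_]; last exact: monicPhi.
    by rewrite monicE lead_coefDl ?sizePhi ?ltnS// -monicE monicPhi.
  rewrite -(dot_krylov_poly (n := N.+1)) ?sPsi// !kPsi.
  by rewrite dot_krylov_poly ?sizePhi// oPhi.
rewrite /Psi eqxx => /eqP; rewrite -subr_eq0 addrC addKr => /eqP p0.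
by rewrite -[c]rVpolyK -/p p0 linear0.
Qed.

(** The hypothesis gives orthogonality to each [Phi k] with [k < N]; subtracting the multiple of the
    monic [Phi k] with the leading coefficient of [q] lowers the degree, and induction applies. *)
Lemma Phi_orthogonal q : (size q <= N)%N ->
  dotL2 (krylov_poly N.+1 (Phi N)) (krylov_poly N.+1 q) = 0.
Proof.
have [[_ oPhi] _] := hPhi.
suff h k : (k <= N)%N -> forall q, (size q <= k)%N ->
    dotL2 (krylov_poly N.+1 (Phi N)) (krylov_poly N.+1 q) = 0 by exact: (h N).
elim: k => [_ {}q|k ih kN {}q sq].
  by rewrite leqn0 size_poly_eq0 => /eqP ->; rewrite linear0 dotL2_conj dotL20 conjc0.
rewrite (_ : q = q`_k *: Phi k + (q - q`_k *: Phi k)); last by rewrite addrC subrK.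
have kN' := ltnW kN.
rewrite linearD linearZ dotL2Dr dotL2Zr (ih kN' (_ - _)) ?addr0.
  rewrite dot_krylov_poly ?sizePhi//.
  by rewrite oPhi ?gtn_eqF// mulr0.
apply/leq_sizeP => j; rewrite leq_eqVlt coefB coefZ => /predU1P[<-|kj].
  have /eqP : lead_coef (Phi k) = 1 by apply/eqP; rewrite -monicE monicPhi// ltnW.
  by rewrite lead_coefE sizePhi ?(ltnW kN)//= => /eqP ->; rewrite mulr1 subrr.
rewrite [q`_j]nth_default ?(leq_trans sq)//.
by rewrite [_`_j]nth_default ?sizePhi// mulr0 subrr.
Qed.

(** The companion matrix of [Phi N] with coordinates in rows: [U] shifts the Krylov vectors, and the
    last row expresses the projection of [U^N f]. *)
Definition dmd_mx : 'M[R[i]]_N :=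
  \matrix_(i, j) if i.+1 == N then - (Phi N)`_j else (i.+1 == j)%:R.

Lemma hankel_dmd_mx (c : 'rV_N) :
  hankel_dmd U f N (lincomb b c) = lincomb b (c *m dmd_mx).
Proof.
(* On the Krylov space the inner projection is the identity, so only the outer one has to be
   computed. *)
have projc : proj_on (span_of b) (lincomb b c) = lincomb b c.
  by apply: proj_on_unique => [|w _]; [exists c | rewrite subrr dotL20].
rewrite /hankel_dmd /krylov projc.
apply: proj_on_unique; first by exists (c *m dmd_mx).
move=> _ [a _ <-]; rewrite [in U _]/lincomb (linear_sum_scale _ _ _ linU).
rewrite lincomb_mulmx /lincomb -sumrB dotL2_suml big1// => i _.
rewrite -scalerBr dotL2Zl; apply/eqP; rewrite mulf_eq0; apply/orP; right; apply/eqP.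
rewrite -!/(lincomb _ _) -iterS.
(* Before the last index, [U] sends a Krylov vector to the next one, still in the span, and the
   residual is zero. *)
have [iN|iN] := eqVneq i.+1 N; last first.
  have lt : (i.+1 < N)%N by rewrite ltn_neqAle iN ltn_ord.
  rewrite (_ : row i dmd_mx = delta_mx 0 (Ordinal lt)).
    by rewrite lincomb_delta subrr dotL20.
  by apply/rowP => j; rewrite !mxE (negPf iN) eqxx -val_eqE /= eq_sym.
(* At the last index the residual is [Phi_N(U) f], whose leading term is [U^N f] since [Phi N] is
   monic. *)
rewrite (_ : _ - _ = krylov_poly N.+1 (Phi N)).
  have sa : (size (rVpoly a) <= N)%N by exact: size_poly.
  by rewrite lincomb_krylov -(krylov_poly_widen (m := N.+1) sa)// Phi_orthogonal.
rewrite iN /krylov_poly big_ord_recr /= [RHS]addrC; congr (_ + _).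
  have := monicPhi (leqnn N); rewrite monicE lead_coefE sizePhi// => /eqP /= ->.
  by rewrite scale1r.
rewrite -sumrN; apply: eq_bigr => j _.
by rewrite !mxE iN eqxx scaleNr opprK.
Qed.

End orthogonal.
End krylov_polynomials.

(** * The characteristic polynomial and eigenvalues of the Hankel DMD operator *)

Unset Implicit Arguments.
Set Strict Implicit.

Theorem theorem8 (d : measure_display) (X : measurableType d) (R : realType)
    (nu : {measure set X -> \bar R}) (T : X -> X)
    (hT : invertible_measure_preserving nu T)
    (E : pvm nu) (hE : is_spectral_measure_of (koopman hT) E)
    (f : L2 nu) (N : nat) (hN : (1 <= N)%N)
    (Phi : nat -> {poly R[i]})
    (hPhi : orthogonal_polynomials (spectral_measure E f) N Phi) :
  let U_N := hankel_dmd (koopman hT) f N in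
  let F_N := krylov (koopman hT) f N in
  is_char_poly F_N U_N (Phi N) /\
  (forall a : R[i], root (Phi N) a <-> is_eigenvalue F_N U_N a) /\
  (forall a : R[i], has_multiplicity F_N U_N a (mup a (Phi N))).
Proof.
move=> U_N F_N.
have lin := koopman_linear hT; have iso := koopman_isometry hT.
have bF : basis_of_set F_N (fun i : 'I_N => iter i (koopman hT) f).
  by have inj := krylov_free lin iso hE hPhi; split.
have LM := hankel_dmd_mx lin iso hE hPhi.
have [[mPhi _] _] := hPhi; have [mN sN] := mPhi N (leqnn N).
have cM : char_poly (dmd_mx N Phi) = Phi N by exact: char_poly_companion.
have cP : is_char_poly F_N U_N (Phi N) by rewrite -cM; exact: is_char_poly_basis bF LM.
split=> //; split=> a; last by exists (Phi N).
by rewrite -cM; exact: is_eigenvalue_basis bF LM.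
Qed.
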